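(* Let $s\ge 2$ be an integer and let $\Sigma\subset CAT(\Lambda_s^{\mathbb Z})$ be a maximal commutative semigroup. Then $\Sigma_+$ is maximal commutative in $CAT(\Lambda_s^{\mathbb N})$.
   Context: $\mathbb N$ includes $0$. $\Lambda_s=\{0,1,\dots,s-1\}$ is the symbol set (discrete topology); $\Lambda_s^{\mathbb N}$ and $\Lambda_s^{\mathbb Z}$ are the spaces of one-sided and two-sided sequences, with the product topology. On both, $\sigma$ is the left shift, $\sigma(a)_k=a_{k+1}$. For $\Omega=\Lambda_s^{\mathbb N}$ or $\Lambda_s^{\mathbb Z}$, $CAT(\Omega)$ is the semigroup (under composition) of all continuous maps $\tau:\Omega\to\Omega$ with $\tau\sigma=\sigma\tau$. Embedding of $CAT(\Lambda_s^{\mathbb N})$ in $CAT(\Lambda_s^{\mathbb Z})$: every $\tau\in CAT(\Lambda_s^{\mathbb N})$ is given by a block map $f_\tau:\Lambda_s^{r+1}\to\Lambda_s$ for some $r\in\mathbb N$, via $\tau(a)_k=f_\tau(a_k a_{k+1}\dots a_{k+r})$ for all $k$; the same formula for all $k\in\mathbb Z$ defines an element of $CAT(\Lambda_s^{\mathbb Z})$. Under this correspondence $CAT(\Lambda_s^{\mathbb N})$ is regarded as a subset of $CAT(\Lambda_s^{\mathbb Z})$. For a semigroup $\Sigma\subset CAT(\Lambda_s^{\mathbb Z})$ with $\sigma\in\Sigma$ (automatic when $\Sigma$ is maximal commutative), $\Sigma_+=\Sigma\cap CAT(\Lambda_s^{\mathbb N})$, regarded as a semigroup acting on $\Lambda_s^{\mathbb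 N}$. A semigroup $\Sigma\subset CAT(\Omega)$ is maximal commutative (MC) in $CAT(\Omega)$ if (1) $\Sigma$ is commutative, and (2) every $\mu\in CAT(\Omega)$ with $\mu\tau=\tau\mu$ for all $\tau\in\Sigma$ belongs to $\Sigma$. *)

(* Defs.v *)
From HB Require Import structures.
From mathcomp Require Import all_boot all_order all_algebra.
From mathcomp Require Import all_classical all_reals all_analysis.

Set Implicit Arguments.
Unset Strict Implicit.
Unset Printing Implicit Defensive.

Import GRing.Theory.
Local Open Scope classical_set_scope.
Local Open Scope ring_scope.

(* The index type [I] is meant to be [nat] (one-sided sequences) or [int]
   (two-sided sequences); both are semirings, so that [k + 1] and
   [k + j%:R], with [j : nat], make sense uniformly. *)

Definition full_shift (I : pzSemiRingType) (s : nat) : topologicalType :=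
  prod_topology (fun _ : I => discrete_topology 'I_s).

Definition left_shift (I : pzSemiRingType) (s : nat) (a : full_shift I s) :
    full_shift I s :=
  fun k => a (k + 1).

Definition CAT (I : pzSemiRingType) (s : nat) :
    set (full_shift I s -> full_shift I s) :=
  [set tau | continuous tau /\ tau \o @left_shift I s = @left_shift I s \o tau].

Definition block_code (I : pzSemiRingType) (s r : nat)
    (f : r.+1.-tuple 'I_s -> 'I_s) (a : full_shift I s) : full_shift I s :=
  fun k => f [tuple a (k + (j : nat)%:R) | j < r.+1].

Definition is_embedding (s : nat) (tau : full_shift nat s -> full_shift nat s)
    (tau' : full_shift int s -> full_shift int s) : Prop :=
  exists r (f : r.+1.-tuple 'I_s -> 'I_s),
    tau = block_code f /\ tau' = block_code f.

(* The intersection of [Sigma] with the one-sided maps, regarded as a set of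
   maps of one-sided sequences. *)
Definition plus_part (s : nat)
    (Sigma : set (full_shift int s -> full_shift int s)) :
    set (full_shift nat s -> full_shift nat s) :=
  [set tau | CAT tau /\ exists2 tau', is_embedding tau tau' & Sigma tau'].

Definition composition_semigroup (T : Type) (Sigma : set (T -> T)) : Prop :=
  forall mu tau, Sigma mu -> Sigma tau -> Sigma (mu \o tau).

Definition commutative_family (T : Type) (Sigma : set (T -> T)) : Prop :=
  forall mu tau, Sigma mu -> Sigma tau -> mu \o tau = tau \o mu.

Definition maximal_commutative (I : pzSemiRingType) (s : nat)
    (Sigma : set (full_shift I s -> full_shift I s)) : Prop :=
  [/\ Sigma `<=` @CAT I s, composition_semigroup Sigma, commutative_family Sigma &
      forall mu, CAT mu ->
        (forall tau, Sigma tau -> mu \o tau = tau \o mu) -> Sigma mu].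

(* Main.v *)
(** The commutation of a one-sided map [mu] with [plus_part Sigma] extends to
    all of [Sigma]: by Curtis-Hedlund-Lyndon, every [tau] in [Sigma] becomes
    one-sided after composition with a high power of the shift, which itself
    lies in [Sigma] because it commutes with all of [CAT].  Hence the two-sided
    version of [mu] commutes with [sigma^m tau], and therefore with [tau] as
    [sigma^m] is injective on two-sided sequences. *)

Require Import Defs.
From mathcomp Require Import all_boot all_order all_algebra.
From mathcomp Require Import all_classical all_reals all_analysis.
From mathcomp Require Import zify.

Set Implicit Arguments.
Unset Strict Implicit.
Unset Printing Implicit Defensive.

Import GRing.Theory.
Local Open Scope classical_set_scope.
Local Open Scope ring_scope.

(** * Topology of the full shift: cylinders and compactness *)

Section FullShift.
Variables (I : pzSemiRingType) (s : nat).
Implicit Types (a b : full_shift I s) (T : full_shift I s -> full_shift I s).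

Lemma cvg_full_shift (F : set_system (full_shift I s)) a :
  Filter F -> (forall i, F [set b | b i = a i]) -> F --> a.
Proof.
move=> FF Fa; apply/cvg_sup => i U [_ [[C oC <-] /= Ca] /filterS]; apply.
by apply: filterS (Fa i) => b /= ba; rewrite ba.
Qed.

Lemma nbhs_coord a i : nbhs a [set b | b i = a i].
Proof.
have /cvg_sup/(_ i) : nbhs a --> a by [].
apply; exists [set b | b i = a i]; split => //.
by exists [set a i] => //; exact: (@discrete_open (discrete_topology 'I_s)).
Qed.

Lemma nbhs_cylinder a (S : seq I) : nbhs a [set b : full_shift I s | {in S, b =1 a}].
Proof.
elim: S => [|i S IHS]; first by apply: filterS filterT.
apply: filterS (filterI (nbhs_coord a i) IHS) => b [bi bS] j.
by rewrite inE => /predU1P[->//|]; exact: bS.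
Qed.

(** The cylinders around [a] generate a filter that converges to [a] coordinatewise, so it refines
    the neighbourhood filter. *)
Lemma nbhs_sub_cylinder a (A : set (full_shift I s)) : nbhs a A ->
  exists S : seq I, forall b, {in S, b =1 a} -> A b.
Proof.
pose W (S : seq I) := [set b : full_shift I s | {in S, b =1 a}].
pose F := filter_from [set: seq I] W.
have FF : Filter F.
  apply: filter_from_filter; first by exists [::].
  move=> S S' _ _; exists (S ++ S') => // b Wb.
  by split=> i iS; apply: Wb; rewrite mem_cat iS ?orbT.
have Fa : F --> a.
  by apply: cvg_full_shift => i; exists [:: i] => // b; apply; rewrite mem_head.
by move=> /Fa[S _ WA]; exists S => b; exact: WA.
Qed.

Lemma continuous_full_shift T :
  continuous T <-> forall a k, nbhs a [set b | T b k = T a k].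
Proof.
split=> [cT a k|cT a]; first exact: (cT a _ (nbhs_coord (T a) k)).
have FT := fmap_filter T (nbhs_filter a).
exact: (@cvg_full_shift _ (T a) FT (cT a)).
Qed.

Lemma compact_full_shift : compact [set: full_shift I s].
Proof.
have fin : finite_set [set: discrete_topology 'I_s] by exact: (@finite_finset 'I_s).
rewrite (_ : setT = [set f : full_shift I s | forall i, setT (f i)]); last first.
  by apply/seteqP.
exact: (@tychonoff I (fun=> discrete_topology 'I_s) (fun=> setT)
  (fun=> finite_compact fin)).
Qed.

(** By continuity a finite window suffices near each point. Compactness, in near-covering form along
    the filter of finite windows ordered by inclusion, makes one window serve all points. *)
Lemma continuous_finite_window T : continuous T ->
  exists S : seq I, forall a b, {in S, a =1 b} -> T a 0 = T b 0.
Proof.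
move=> cT; have /compact_near_coveringP cpt := compact_full_shift.
pose P (S : seq I) a := forall b, {in S, a =1 b} -> T a 0 = T b 0.
pose G := filter_from [set: seq I] (fun S => [set S' : seq I | {subset S <= S'}]).
have FG : Filter G.
  apply: filter_from_filter; first by exists [::].
  move=> S S' _ _; exists (S ++ S') => // S'' sub.
  by split=> i iS; apply: sub; rewrite mem_cat iS ?orbT.
have [a _|S _ GP] := cpt (seq I) G P FG; last first.
  by exists S => a; apply: GP.
have [S Sa] := nbhs_sub_cylinder ((continuous_full_shift T).1 cT a 0).
(* If [b] agrees with [a] on [S] and [c] agrees with [b] on a larger [S'], then [c] also agrees with
   [a] on [S], so [T b 0] and [T c 0] both equal [T a 0]. *)
exists ([set b : full_shift I s | {in S, b =1 a}], [set S' : seq I | {subset S <= S'}]).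
  by split; [exact: nbhs_cylinder | exists S].
move=> [b S'] /= [ba SS'] c bc.
rewrite (Sa b ba) (Sa c) // => i iS.
by rewrite -ba // bc //; exact: SS'.
Qed.

(** The function [h] measures the size of an index; [id] on [nat] and [absz] on [int] turn the
    finite window into an interval. *)
Lemma continuous_bounded_window (h : I -> nat) T : continuous T ->
  exists n, forall a b,
    (forall i, (h i <= n)%N -> a i = b i) -> T a 0 = T b 0.
Proof.
move=> /continuous_finite_window[S TS]; exists (\max_(i <- S) h i)%N => a b ab.
by apply: TS => i iS; apply: ab; exact: leq_bigmax_seq.
Qed.

End FullShift.

(** * Block codes and the Curtis-Hedlund-Lyndon theorem *)

Section BlockCode.
Variables (I : pzSemiRingType) (s : nat).
Implicit Types (a b : full_shift I s) (T : full_shift I s -> full_shift I s).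

Definition translate (k : I) a : full_shift I s := fun i => a (i + k).

Lemma translateD k l a : translate (k + l) a = translate l (translate k a).
Proof. by apply/funext => i; rewrite /translate addrAC addrA. Qed.

Lemma CAT_translate k : CAT (translate k).
Proof.
split; first by apply/continuous_full_shift => a l; exact: nbhs_coord.
by apply/funext => a; apply/funext => i; rewrite /= /translate /left_shift addrAC.
Qed.

Lemma CAT_comp T T' : CAT T -> CAT T' -> CAT (T \o T').
Proof.
move=> [cT eT] [cT' eT']; split; last by rewrite -compA eT' compA eT.
by move=> a; exact: continuous_comp (cT' a) (cT _).
Qed.

Lemma CAT_translate_nat T n a : CAT T ->
  T (translate n%:R a) = translate n%:R (T a).
Proof.
move=> [_ eT]; have translate1 (b : full_shift I s) : translate 1 b = left_shift b by [].
elim: n => [|n IHn].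
  by rewrite (_ : translate _ = id) //; apply/funext => b; apply/funext => i;
    rewrite /translate addr0.
by rewrite -addn1 natrD !translateD !translate1 -IHn -[LHS]/((T \o _) _) eT.
Qed.

Lemma CAT_block_code r (f : r.+1.-tuple 'I_s -> 'I_s) : CAT (@block_code I s r f).
Proof.
split.
  apply/continuous_full_shift => a k.
  apply: filterS (nbhs_cylinder a [seq k + j%:R | j <- iota 0 r.+1]) => b ab.
  congr f; apply: eq_from_tnth => j; rewrite !tnth_mktuple.
  by apply: ab; apply/mapP; exists (j : nat) => //; rewrite mem_iota ltn_ord.
apply/funext => a; apply/funext => k; congr f; apply: eq_from_tnth => j.
by rewrite !tnth_mktuple /left_shift addrAC.
Qed.

(** Comparing two positions [k] and [l] makes the hypothesis express locality and shift invariance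
    at once, so the symbol produced depends on the word alone. *)
Lemma local_rule_block_code T r : (0 < s)%N ->
  (forall a b k l, (forall j, (j <= r)%N -> a (k + j%:R) = b (l + j%:R)) ->
    T a k = T b l) ->
  exists f : r.+1.-tuple 'I_s -> 'I_s, T = block_code f.
Proof.
move=> s_gt0 Tloc.
pose word a k := [tuple a (k + (j : nat)%:R) | j < r.+1].
have [f fT] : {f : r.+1.-tuple 'I_s -> 'I_s | forall a k, f (word a k) = T a k}.
  have /choice[f fP] w : exists x, forall a k, word a k = w -> T a k = x.
    have [[[a k] /= <-]|nw] := pselect (exists ak, word ak.1 ak.2 = w).
      exists (T a k) => b l /(congr1 (@tnth _ _)) bw; apply: Tloc => j jr.
      have := congr1 (@^~ (Ordinal (jr : (j < r.+1)%N))) bw.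
      by rewrite !tnth_mktuple.
    (* A word that never occurs gets the symbol 0 as default. *)
    by exists (Ordinal s_gt0) => a k aw; case: nw; exists (a, k).
  by exists f => a k; rewrite -(fP _ a k).
by exists f; apply/funext => a; apply/funext => k; rewrite -fT.
Qed.

End BlockCode.

Lemma Curtis_Hedlund_Lyndon_nat s (T : full_shift nat s -> full_shift nat s) :
  (0 < s)%N -> CAT T -> exists r (f : r.+1.-tuple 'I_s -> 'I_s), T = block_code f.
Proof.
move=> s_gt0 CT; have [r Tr] := continuous_bounded_window id CT.1.
exists r; apply: local_rule_block_code => // a b k l ab.
have T0 c (m : nat) : T c m = T (translate m%:R c) 0.
  by rewrite CAT_translate_nat // /translate add0r natn.
rewrite (T0 a) (T0 b); apply: Tr => i ir; rewrite /translate ![i + _]addrC !natn.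
by have := ab i ir; rewrite !natn.
Qed.

Lemma CAT_translate_int s (T : full_shift int s -> full_shift int s) (k : int) a :
  CAT T -> T (translate k a) = translate k (T a).
Proof.
move=> CT; have translate0 (b : full_shift int s) : translate 0 b = b.
  by apply/funext => i; rewrite /translate addr0.
case: (intP k) => [|n|n]; first by rewrite !translate0.
  by rewrite -natz CAT_translate_nat.
(* For a negative shift, [a] is written as the translate by [n.+1] of its translate by [- n.+1]; the
   outer translate passes through [T] and cancels. *)
rewrite -[in RHS](translate0 a) -(addNr n.+1%:Z) translateD -natz.
by rewrite CAT_translate_nat // -translateD addrN translate0.
Qed.

Lemma Curtis_Hedlund_Lyndon_int s (T : full_shift int s -> full_shift int s) :
  (0 < s)%N -> CAT T ->
  exists m r (f : r.+1.-tuple 'I_s -> 'I_s), translate m%:R \o T = block_code f.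
Proof.
move=> s_gt0 CT; have [m Tm] := continuous_bounded_window absz CT.1.
exists m, (m + m)%N; apply: local_rule_block_code => // a b k l ab.
have T0 c (i : int) : (translate m%:R \o T) c i = T (translate (i + m%:R) c) 0.
  by rewrite CAT_translate_int // /translate /= add0r.
(* The shift by [m] moves the symmetric window from [-m] to [m] onto the offsets [0] to [m + m],
   which a block map can read. *)
have window (i : int) : (`|i| <= m)%N ->
    exists2 j, (j <= m + m)%N & forall n : int, i + (n + m%:R) = n + j%:R.
  by move=> im; exists (absz (i + m%:Z)) => [|n]; rewrite ?natz; lia.
rewrite (T0 a) (T0 b); apply: Tm => i /window[j jm shift]; rewrite /translate.
by rewrite !shift; exact: ab.
Qed.

(** * The embedding of one-sided maps, seen through restriction to half-lines *)

Section Embedding.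
Variable s : nat.
Implicit Types (a : full_shift int s)
  (tau mu : full_shift nat s -> full_shift nat s).

Definition restrict (k : int) a : full_shift nat s := fun n => a (k + n%:Z).

Lemma restrict0_surj (b : full_shift nat s) : exists a, restrict 0 a = b.
Proof. by exists (fun i => b `|i|%N); apply/funext => n; rewrite /restrict add0r. Qed.

Lemma block_code_restrict r (f : r.+1.-tuple 'I_s -> 'I_s) k a :
  block_code f (restrict k a) = restrict k (block_code f a).
Proof.
apply/funext => n; congr f; apply: eq_from_tnth => j; rewrite !tnth_mktuple.
by rewrite /restrict natn natz -addrA.
Qed.

(** This frees the embedding from the choice of a block map. A block map reads only to the right, so
    it ignores what [restrict k] forgets; conversely, the first symbol of each [restrict k] recovers
    [tau'] at [k]. *)
Lemma is_embeddingP tau (tau' : full_shift int s -> full_shift int s) :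
  (0 < s)%N -> CAT tau ->
  is_embedding tau tau' <-> forall k a, tau (restrict k a) = restrict k (tau' a).
Proof.
move=> s_gt0 Ctau; split=> [[r [f [-> ->]]] k a|tauE].
  exact: block_code_restrict.
have [r [f tauf]] := Curtis_Hedlund_Lyndon_nat s_gt0 Ctau.
exists r, f; split=> //; apply/funext => a; apply/funext => k.
have := congr1 (@^~ 0%N) (tauE k a); rewrite tauf block_code_restrict.
by rewrite /restrict addr0.
Qed.

(** Commutation descends because [restrict 0] is surjective, and lifts because the maps [restrict k]
    jointly separate two-sided sequences. *)
Lemma is_embedding_comm tau mu (tau' mu' : full_shift int s -> full_shift int s) :
  (0 < s)%N -> CAT tau -> CAT mu ->
  is_embedding tau tau' -> is_embedding mu mu' ->
  tau \o mu = mu \o tau <-> tau' \o mu' = mu' \o tau'.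
Proof.
move=> s_gt0 Ctau Cmu /is_embeddingP tauE /is_embeddingP muE.
have {}tauE := tauE s_gt0 Ctau; have {}muE := muE s_gt0 Cmu.
split=> [comm|comm']; last first.
  apply/funext => b; have [a <-] := restrict0_surj b.
  by rewrite /= muE !tauE muE -[tau' _]/((tau' \o mu') a) comm'.
apply/funext => a; apply/funext => k.
have restrictE c : c k = restrict k c 0%N by rewrite /restrict addr0.
rewrite restrictE [RHS]restrictE /= -tauE -!muE -tauE -[LHS]/((tau \o mu) _ _).
by rewrite comm.
Qed.

End Embedding.

Theorem theorem4p4 (s : nat) (hs : (2 <= s)%N)
    (Sigma : set (full_shift int s -> full_shift int s))
    (hSigma : maximal_commutative Sigma) :
  maximal_commutative (plus_part Sigma).
Proof.
have s_gt0 : (0 < s)%N by exact: ltnW.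
have [SigmaCAT SigmaM SigmaC Sigma_max] := hSigma.
split=> [tau []//|tau mu|tau mu|mu Cmu mu_comm].
- move=> [Ctau [tau' tauE Stau']] [Cmu [mu' muE Smu']].
  have Ctm := CAT_comp Ctau Cmu; split=> //.
  exists (tau' \o mu'); last exact: SigmaM.
  apply/is_embeddingP => // k a /=.
  by rewrite ((is_embeddingP _ s_gt0 Cmu).1 muE) ((is_embeddingP _ s_gt0 Ctau).1 tauE).
- move=> [Ctau [tau' tauE Stau']] [Cmu [mu' muE Smu']].
  by apply/(is_embedding_comm s_gt0 Ctau Cmu tauE muE); exact: SigmaC.
have [r [f muf]] := Curtis_Hedlund_Lyndon_nat s_gt0 Cmu.
have Cmu' : CAT (@block_code int s r f) by exact: CAT_block_code.
have muE : is_embedding mu (block_code f) by exists r, f.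
split=> //; exists (block_code f) => //; apply: (Sigma_max) => // tau Stau.
have Ctau := SigmaCAT _ Stau.
have [m [p [g taug]]] := Curtis_Hedlund_Lyndon_int s_gt0 Ctau.
have Sg : Sigma (block_code g).
  rewrite -taug; apply: SigmaM => //; apply: (Sigma_max).
    exact: CAT_translate.
  move=> nu /SigmaCAT Cnu; apply/funext => a.
  by rewrite /= CAT_translate_int.
have gE : is_embedding (block_code g) (@block_code int s p g) by exists p, g.
have Cg : CAT (@block_code nat s p g) by exact: CAT_block_code.
have comm : block_code f \o (translate m%:R \o tau) =
    (translate m%:R \o tau) \o block_code f.
  (* The question moves to one-sided maps, where the one-sided [block_code g] lies in
     [plus_part Sigma] and [mu_comm] applies. *)
  rewrite taug; apply/(is_embedding_comm s_gt0 Cmu Cg muE gE).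
  by apply: mu_comm; split=> //; exists (block_code g).
apply/funext => a; apply/funext => k.
(* Evaluating at [k - m%:R] cancels the shift; this position exists because the indices are
   integers. *)
have := congr1 (fun T => T a (k - m%:R)) comm.
by rewrite /= CAT_translate_int // /translate subrK.
Qed.
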